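(* Let $G=(V,E)$ be a graph with at least one edge and let $k$ be a positive integer. Then $\operatorname{mmw}(G)\le k$ if and only if there is a tree $T$ of maximum degree at most $3$ and, for each vertex $u\in V$, a subtree $T_u$ of $T$ having at least one edge, such that (i) if $uv\in E$ then $T_u$ and $T_v$ have at least one vertex of $T$ in common, and (ii) every edge of $T$ is contained in at most $k$ of the subtrees $T_u$, $u\in V$.
   Context: A branch decomposition over a set $X$ is a pair $(T,\delta)$ with $T$ a tree whose vertices have degree at most $3$ and $\delta$ a bijection from the leaves of $T$ to $X$; each edge of $T$ induces a partition of $X$ into the two sets of elements mapped from leaves of the two components of $T$ minus that edge. For $S\subseteq V(G)$, $\operatorname{mm}(S)$ is the size of a maximum matching in the bipartite graph with parts $S$ and $V(G)\setminus S$ whose edges are the edges of $G$ between them. The mm-width of a branch decomposition $(T,\delta)$ over $V(G)$ is the maximum of $\operatorname{mm}(A)$ over all partitions $(A,B)$ induced by edges of $T$, and the maximum matching width $\operatorname{mmw}(G)$ is the minimum mm-width over all branch decompositions over $V(G)$ (if $|V(G)|\le1$ it is defined as $\operatorname{mm}(\emptyset)=0$). *)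

(* Defs.v *)
From mathcomp Require Import zify all_boot boolp.
Set Implicit Arguments.
Unset Strict Implicit.
Unset Printing Implicit Defensive.

Record sgraph := SGraph {
  vertex :> finType;
  adj : rel vertex;
  adj_sym : symmetric adj;
  adj_irrefl : irreflexive adj }.

Notation "x -- y" := (adj x y) (at level 30, no associativity).

Definition degree (G : sgraph) (x : G) : nat := #|[set y | x -- y]|.

Definition subcubic (G : sgraph) : Prop := forall x : G, degree x <= 3.

Definition connected (G : sgraph) : Prop := forall x y : G, connect (@adj G) x y.

(* [cycle] also accepts [:: x; y] when [x -- y]; graph cycles have length at
   least 3. *)
Definition acyclic (G : sgraph) : Prop :=
  forall c : seq G, uniq c -> 2 < size c -> ~~ cycle (@adj G) c.

Definition is_tree (G : sgraph) : Prop := [/\ 0 < #|G|, connected G & acyclic G].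

Definition is_leaf (G : sgraph) (x : G) : bool := degree x == 1.

Definition leaf (G : sgraph) : finType := {x : G | is_leaf x}.

Record subgraph (G : sgraph) := Subgraph {
  sub_vertices : {set G};
  sub_edge : rel G;
  sub_edge_sym : symmetric sub_edge;
  sub_edge_adj : forall x y, sub_edge x y -> x -- y;
  sub_edge_vertices :
    forall x y, sub_edge x y -> (x \in sub_vertices) && (y \in sub_vertices) }.

Section SubgraphGraph.
Variables (G : sgraph) (H : subgraph G).

Definition subgraph_adj : rel {x : G | x \in sub_vertices H} :=
  fun x y => sub_edge H (val x) (val y).

Lemma subgraph_adj_sym : symmetric subgraph_adj.
Proof. by move=> x y; apply: sub_edge_sym. Qed.

Lemma subgraph_adj_irrefl : irreflexive subgraph_adj.
Proof.
by move=> x; apply/negP => /sub_edge_adj; rewrite adj_irrefl.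
Qed.

Definition graph_of_subgraph : sgraph :=
  SGraph subgraph_adj_sym subgraph_adj_irrefl.

End SubgraphGraph.

Definition is_subtree (T : sgraph) (H : subgraph T) : Prop :=
  is_tree (graph_of_subgraph H).

Definition edges (G : sgraph) : {set {set G}} :=
  [set [set p.1; p.2] | p : G * G & p.1 -- p.2].

Definition is_matching (G : sgraph) (M : {set {set G}}) : bool :=
  (M \subset edges G) && trivIset M.

Definition max_matching (G : sgraph) : nat :=
  \max_(M : {set {set G}} | is_matching M) #|M|.

Section Cut.
Variables (G : sgraph) (S : {set G}).

Definition cut_adj : rel G := fun x y => (x -- y) && ((x \in S) != (y \in S)).

Lemma cut_adj_sym : symmetric cut_adj.
Proof. by move=> x y; rewrite /cut_adj adj_sym eq_sym. Qed.

Lemma cut_adj_irrefl : irreflexive cut_adj.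
Proof. by move=> x; rewrite /cut_adj adj_irrefl. Qed.

Definition cut_graph : sgraph := SGraph cut_adj_sym cut_adj_irrefl.

Definition mm : nat := max_matching cut_graph.

End Cut.

Record branch_dec (X : finType) := BranchDec {
  bd_tree : sgraph;
  bd_is_tree : is_tree bd_tree;
  bd_subcubic : subcubic bd_tree;
  bd_map : leaf bd_tree -> X;
  bd_map_bij : bijective bd_map }.

Definition remove_edge (G : sgraph) (a b : G) : rel G :=
  fun x y => (x -- y) && ([set x; y] != [set a; b]).

(* For an edge [ab] of the tree, the induced partition of [X] consists of
   [bd_side a b] and [bd_side b a]. *)
Definition bd_side (X : finType) (D : branch_dec X) (a b : bd_tree D) : {set X} :=
  [set bd_map l | l : leaf (bd_tree D) & connect (remove_edge a b) a (val l)].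

Definition mm_width (G : sgraph) (D : branch_dec G) : nat :=
  \max_(p : bd_tree D * bd_tree D | p.1 -- p.2) mm (bd_side p.1 p.2).

(* Every set with at least two elements has a branch decomposition, given by a
   caterpillar: a spine [inl i] with a pendant leaf [inr i] at each spine
   vertex. *)
Section Caterpillar.
Variable n : nat.

Definition cat_adj (x y : 'I_n + 'I_n) : bool :=
  match x, y with
  | inl i, inl j => (i.+1 == j :> nat) || (j.+1 == i :> nat)
  | inl i, inr j | inr j, inl i => i == j
  | inr _, inr _ => false
  end.

Lemma cat_adj_sym : symmetric cat_adj.
Proof. by move=> [i|i] [j|j] //=; rewrite orbC. Qed.

Lemma cat_adj_irrefl : irreflexive cat_adj.
Proof. by move=> [i|i] //=; apply/negP; lia. Qed.

Definition caterpillar : sgraph := SGraph cat_adj_sym cat_adj_irrefl.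

Lemma caterpillar_connected : connected caterpillar.
Proof.
have csym := sym_connect_sym cat_adj_sym.
have spine (m : nat) (i j : 'I_n) : i = m :> nat -> j <= i ->
    connect cat_adj (inl j) (inl i).
  elim: m i => [|m IH] i im ji.
    by have -> : j = i by apply: val_inj => /=; lia.
  case: (eqVneq j i) => [-> //|/eqP ne].
  have ne' : j <> i :> nat by move=> h; apply: ne; apply: val_inj.
  have hm : m < n by have := ltn_ord i; lia.
  apply: (connect_trans (IH (Ordinal hm) erefl _)); first by rewrite /=; lia.
  by apply: connect1 => /=; rewrite im eqxx.
have ss (i j : 'I_n) : connect cat_adj (inl j) (inl i).
  case: (leqP j i) => h; first exact: (spine i).
  by rewrite csym; apply: (spine j) => //; apply: ltnW.
have ls (i : 'I_n) : connect cat_adj (inr i) (inl i).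
  by apply: connect1 => /=; rewrite eqxx.
move=> [i|i] [j|j]; rewrite /adj /=.
- exact: ss.
- by apply: (connect_trans (ss j i)); rewrite csym; apply: ls.
- exact: (connect_trans (ls i) (ss j i)).
- apply: (connect_trans (ls i)); apply: (connect_trans (ss j i)).
  by rewrite csym; apply: ls.
Qed.

Definition cat_rank (x : 'I_n + 'I_n) : nat := if x is inl i then i : nat else n.

Lemma cat_rank_inj (x y z : 'I_n + 'I_n) :
    cat_adj x y -> cat_adj x z -> cat_rank y <= cat_rank x ->
    cat_rank z <= cat_rank x -> y = z.
Proof.
case: x y z => [i|i] [j|j] [k|k] //=.
- move=> h1 h2 h3 h4; congr inl; apply: val_inj => /=; lia.
- by move=> _ _ _; have := ltn_ord i; lia.
- by move=> _ _; have := ltn_ord i; lia.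
- by move=> _ _; have := ltn_ord i; lia.
- by move=> /eqP -> /eqP ->.
Qed.

Lemma caterpillar_acyclic : acyclic caterpillar.
Proof.
move=> c Uc sz; apply/negP => cyc.
have [x0 x0c] : exists x, x \in c.
  by case: c sz {Uc cyc} => // x c _; exists x; rewrite inE eqxx.
have [x xc xmax] := @arg_maxnP _ x0 (mem c) cat_rank x0c.
have Enp : next c x = prev c x.
  apply: (@cat_rank_inj x).
  - exact: (next_cycle cyc xc).
  - by rewrite cat_adj_sym; apply: (prev_cycle cyc xc).
  - by apply: xmax; rewrite /= mem_next.
  - by apply: xmax; rewrite /= mem_prev.
have [i p Dc] := rot_to xc.
have := Enp; rewrite -(next_rot i Uc) -(prev_rot i Uc) Dc.
have Up : uniq (x :: p) by rewrite -Dc rot_uniq.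
have szp : 2 < size (x :: p) by rewrite -Dc size_rot.
move: Up szp; clear Dc; case: p => [|y [|z p]] Up szp /=; try by []; rewrite ?eqxx => Ey; move: Up => /= Up.
have xyzp : x \notin [:: y, z & p] by case/andP: Up.
have pe (b : caterpillar) q : x \notin q -> prev_at x x b q = last b q.
  elim: q b => [|d q IH] b /=; first by rewrite eqxx.
  by rewrite inE negb_or => /andP [/negbTE -> /IH ->].
move: Ey xyzp; rewrite !inE !negb_or => Ey /and3P [xy xz xp].
move: Ey; rewrite (negbTE xy) (negbTE xz) pe // => Ey.
by case/and3P: Up => _ + _; rewrite {1}Ey mem_last.
Qed.

Lemma caterpillar_subcubic : subcubic caterpillar.
Proof.
move=> x; rewrite /degree; case: x => i.
  have [f fK] : exists f : nat -> 'I_n, forall (j : 'I_n) (k : nat), k = j -> f k = j.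
    exists (insubd i) => j _ ->.
    by apply: val_inj; rewrite val_insubd ltn_ord.
  pose s : seq caterpillar :=
    [:: inr i; inl (f i.-1); inl (f i.+1)].
  apply: leq_trans (card_size s); apply: subset_leq_card; apply/subsetP => y.
  rewrite inE => h; suff [->|->|->] : [\/ y = inr i, y = inl (f i.-1)
    | y = inl (f i.+1)]; rewrite ?inE ?eqxx ?orbT //.
  case: y h => j; rewrite /adj /= => h; last by rewrite (eqP h); apply: Or31.
  case/orP: h => /eqP h; [apply: Or33|apply: Or32]; rewrite (fK j) //; lia.
apply: (@leq_trans 1) => //; rewrite -(cards1 (inl i : caterpillar)).
apply: subset_leq_card; apply/subsetP => -[j|j]; rewrite !inE /adj //=.
Qed.

Lemma caterpillar_leaf (x : caterpillar) :
  1 < n -> is_leaf x = if x is inr _ then true else false.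
Proof.
move=> n1; rewrite /is_leaf /degree; case: x => i.
  have [j hj] : exists j : 'I_n, cat_adj (inl i) (inl j).
    case: (ltnP i.+1 n) => h; first by exists (Ordinal h); rewrite /= eqxx.
    have h' : i.-1 < n by have := ltn_ord i; lia.
    by exists (Ordinal h') => /=; have := ltn_ord i; lia.
  apply/negbTE/eqP => /eqP/cards1P [y Ey].
  have /setP/(_ (inl j)) := Ey; have /setP/(_ (inr i)) := Ey.
  rewrite !inE /adj /= eqxx => /esym/eqP <-.
  by rewrite -/(cat_adj (inl i) (inl j)) hj.
apply/cards1P; exists (inl i); apply/setP => -[j|j]; rewrite !inE /adj //=.
Qed.

End Caterpillar.

Lemma branch_dec_exists (X : finType) : 1 < #|X| -> inhabited (branch_dec X).
Proof.
move=> X1; pose T := caterpillar #|X|.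
have treeT : is_tree T.
  split; [|exact: caterpillar_connected|exact: caterpillar_acyclic].
  by apply/card_gt0P; exists (inl (Ordinal (ltnW X1))).
pose f (l : leaf T) : X :=
  match val l with inl i | inr i => enum_val i end.
have gP (x : X) : is_leaf (inr (enum_rank x) : T) by rewrite caterpillar_leaf.
pose g (x : X) : leaf T := Sub (inr (enum_rank x) : T) (gP x).
have bij_f : bijective f.
  exists g => [l|x]; last by rewrite /f /= enum_rankK.
  apply: val_inj; rewrite /f /=; case: l => /= -[i|i] li.
    by move: (li); rewrite caterpillar_leaf.
  by rewrite enum_valK.
exact: (inhabits (BranchDec treeT (@caterpillar_subcubic _) bij_f)).
Qed.

Lemma mm_width_exists (G : sgraph) : 1 < #|G| ->
  exists w, `[< exists D : branch_dec G, mm_width D = w >].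
Proof.
by move=> /branch_dec_exists [D]; exists (mm_width D); apply/asboolP; exists D.
Qed.

Definition mmw (G : sgraph) : nat :=
  match ltnP 1 #|G| with
  | LtnNotGeq G1 => ex_minn (mm_width_exists G1)
  | GeqNotLtn _ => @mm G set0
  end.

(* Main.v *)
Require Import Defs.
From mathcomp Require Import zify all_boot.
Set Implicit Arguments.
Unset Strict Implicit.
Unset Printing Implicit Defensive.

(* From branch decompositions to subtrees: by König's theorem every cut [(A, B)]
   has a vertex cover of size [mm A], namely [(A :\: S) :|: (nbhd S :\: A)] for a
   set [S \subset A]. Taking for [S] the smallest optimal set, submodularity makes
   [S] monotone in [A], and no edge joins the sets [S] of two disjoint sides.
   Orienting all cuts away from a fixed vertex of [G], it follows that, along any
   path of the tree towards the leaf of [v], once [v] is in the cover it stays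
   there. So the tree edges whose cover contains [v] form a subtree [T_v], and for
   an edge [uv] of [G] every tree edge between the leaves of [u] and [v] is in
   [T_u] or [T_v], whence these meet.

   Conversely, for each vertex [u] in turn an edge of [T_u] is subdivided and a
   leaf for [u] is attached to the new vertex. Then the tree is pruned to the edges
   separating two of these leaves. If an edge of the tree separates the leaves of
   two adjacent vertices [u] and [v], it lies in the connected [T_u] or [T_v], so
   the at most [k] vertices whose subtree contains it cover the cut. *)

(** * König's theorem *)

Lemma leq_cards2 (T : finType) (X1 X2 Y1 Y2 : {set T}) :
  X1 :|: X2 \subset Y1 :|: Y2 -> X1 :&: X2 \subset Y1 :&: Y2 ->
  #|X1| + #|X2| <= #|Y1| + #|Y2|.
Proof.
move=> sU sI; rewrite -(cardsUI X1) -(cardsUI Y1).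
by apply: leq_add; apply: subset_leq_card.
Qed.

Section Konig.
Variables T1 T2 : finType.
Implicit Types (E M : {set T1 * T2}) (X : {set T1}) (Y : {set T2}).

Definition bicover E X Y := [forall p in E, (p.1 \in X) || (p.2 \in Y)].

Lemma bicoverP E X Y :
  reflect (forall x y, (x, y) \in E -> (x \in X) || (y \in Y)) (bicover E X Y).
Proof.
apply: (iffP forall_inP) => [h x y xyE|h [x y] /h //].
exact: (h (x, y)).
Qed.

(** This bounds the vertex cover number of the bipartite graph [E] from below. It is a boolean
    predicate so that [minset] can select an inclusion-minimal [E]. *)
Definition tau_ge t E := [forall X, forall Y, bicover E X Y ==> (t <= #|X| + #|Y|)].

Lemma tau_geP t E :
  reflect (forall X Y, bicover E X Y -> t <= #|X| + #|Y|) (tau_ge t E).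
Proof.
apply: (iffP forallP) => [h X Y cov|h X]; last first.
  by apply/forallP => Y; apply/implyP/h.
by have /forallP/(_ Y)/implyP/(_ cov) := h X.
Qed.

(** By minimality, [E :\ p] has a cover of size less than [t]. If that cover contained an end of
    [p], it would cover all of [E]. *)
Lemma minset_tau_cover t E p : minset (tau_ge t) E -> p \in E ->
  exists X Y, [/\ bicover (E :\ p) X Y, #|X| + #|Y| < t, p.1 \notin X & p.2 \notin Y].
Proof.
move=> /minsetP [tE minE] pE.
have : ~~ tau_ge t (E :\ p).
  apply/negP => /minE /(_ (subD1set _ _)) /setP /(_ p).
  by rewrite !inE eqxx pE.
rewrite negb_forall => /existsP [X]; rewrite negb_forall => /existsP [Y].
rewrite negb_imply -ltnNge => /andP [cov lt]; exists X, Y.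
have nocov : ~~ ((p.1 \in X) || (p.2 \in Y)).
  apply: contraL lt => hp; rewrite -leqNgt; apply: (tau_geP _ _ tE).
  apply/forall_inP => q qE; case: (eqVneq q p) => [-> //|qp].
  by apply: (forall_inP cov); rewrite !inE qp.
by move: nocov; rewrite negb_or => /andP [].
Qed.

(** The size count for uncrossing: the two new covers together exceed the two old ones by at most
    [1]. If each old cover has size at most [t - 1], the new ones sum to at most [2 * t - 1], so
    they cannot both have size at least [t]. *)
Lemma card_bicover_exchange (X X' : {set T1}) (Y Y' : {set T2}) x :
  #|X :&: X'| + #|Y :|: Y'| + (#|x |: (X :|: X')| + #|Y :&: Y'|) <=
  #|X| + #|Y| + (#|X'| + #|Y'|) + 1.
Proof.
have := cardsUI X X'; have := cardsUI Y Y'.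
by have := cardsU1 x (X :|: X'); case: (x \notin _); lia.
Qed.

(* Two edges of [E] with a common end [x] each have a cover of the remaining
   edges of size [< t] that avoids [x]; uncrossing these two covers would
   produce a cover of [E] of size [< t]. *)
Lemma minset_tau_inj1 t E x y y' : minset (tau_ge t) E ->
  (x, y) \in E -> (x, y') \in E -> y = y'.
Proof.
move=> minE xyE xyE'; apply/eqP/negPn/negP => neq.
have [X [Y [cov lt xX yY]]] := minset_tau_cover minE xyE.
have [X' [Y' [cov' lt' xX' yY']]] := minset_tau_cover minE xyE'.
have /minsetp/tau_geP tE := minE.
rewrite /= in xX yY xX' yY'.
have yY2 : y \in Y'.
  have /bicoverP/(_ x y) := cov'; rewrite !inE xyE andbT xpair_eqE eqxx neq.
  by rewrite (negbTE xX') => /(_ isT).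
have yY2' : y' \in Y.
  have /bicoverP/(_ x y') := cov; rewrite !inE xyE' andbT xpair_eqE eqxx.
  by rewrite (negbTE xX) eq_sym neq => /(_ isT).
have covE a b : (a, b) \in E -> (a, b) != (x, y) -> (a \in X) || (b \in Y).
  by move=> abE ne; have /bicoverP/(_ a b) := cov; rewrite !inE ne abE; apply.
have covE' a b : (a, b) \in E -> (a, b) != (x, y') -> (a \in X') || (b \in Y').
  by move=> abE ne; have /bicoverP/(_ a b) := cov'; rewrite !inE ne abE; apply.
have c1 : bicover E (X :&: X') (Y :|: Y').
  apply/bicoverP => a b abE; rewrite !inE.
  case: (eqVneq (a, b) (x, y)) => [[-> ->]|/(covE _ _ abE)].
    by rewrite yY2 !orbT.
  case: (eqVneq (a, b) (x, y')) => [[-> ->]|/(covE' _ _ abE)].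
    by rewrite yY2' !orbT.
  by case: (a \in X); case: (a \in X'); case: (b \in Y); case: (b \in Y').
have c2 : bicover E (x |: (X :|: X')) (Y :&: Y').
  apply/bicoverP => a b abE; rewrite !inE.
  case: (eqVneq a x) => //= ax.
  have := covE _ _ abE; have := covE' _ _ abE.
  rewrite !xpair_eqE (negbTE ax) /= => /(_ isT) + /(_ isT).
  by case: (a \in X); case: (a \in X'); case: (b \in Y); case: (b \in Y').
move: (tE _ _ c1) (tE _ _ c2) (card_bicover_exchange X X' Y Y' x) lt lt'.
by clear; lia.
Qed.
End Konig.

Section SwapSet.
Variables T1 T2 : finType.
Implicit Types (E : {set T1 * T2}) (X : {set T1}) (Y : {set T2}).

Definition swap_set E : {set T2 * T1} := [set (p.2, p.1) | p in E].

Lemma mem_swap_set E x y : ((y, x) \in swap_set E) = ((x, y) \in E).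
Proof.
apply/imsetP/idP => [[[a b] abE [-> ->]] //|xyE].
by exists (x, y).
Qed.

Lemma bicover_swap E X Y : bicover (swap_set E) Y X = bicover E X Y.
Proof.
apply/bicoverP/bicoverP => h x y; rewrite ?mem_swap_set.
  by rewrite orbC -mem_swap_set => /h.
by move/h; rewrite orbC.
Qed.

Lemma tau_ge_swap t E :
  tau_ge t (swap_set E) = tau_ge t E.
Proof.
apply/tau_geP/tau_geP => h X Y.
  by rewrite -bicover_swap addnC; apply: h.
by rewrite bicover_swap addnC; apply: h.
Qed.

End SwapSet.

Lemma swap_setK (T1 T2 : finType) (E : {set T1 * T2}) : swap_set (swap_set E) = E.
Proof. by apply/setP => -[x y]; rewrite !mem_swap_set. Qed.

Lemma minset_swap (T1 T2 : finType) t (E : {set T1 * T2}) :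
  minset (tau_ge t) E -> minset (tau_ge t) (swap_set E).
Proof.
move=> /minsetP [tE minE]; apply/minsetP; rewrite tau_ge_swap; split => // M tM sM.
rewrite -(minE (swap_set M)) ?swap_setK ?tau_ge_swap //.
apply/subsetP => -[x y]; rewrite mem_swap_set => /(subsetP sM).
by rewrite mem_swap_set.
Qed.

(** An inclusion-minimal subset [M] of [E] that still needs [t] vertices to be covered is a
    matching, by [minset_tau_inj1] applied to [M] and to its transpose. It has at least [t] edges
    because the set of its left ends covers it. *)
Lemma konig (T1 T2 : finType) t (E : {set T1 * T2}) :
  (forall X Y, bicover E X Y -> t <= #|X| + #|Y|) ->
  exists M : {set T1 * T2},
    [/\ M \subset E, t <= #|M|, {in M &, injective fst} & {in M &, injective snd}].
Proof.
move=> /tau_geP tE; have [M minM sME] := minset_exists tE; exists M; split=> //.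
- have /minsetp/tau_geP tM := minM.
  apply: leq_trans (tM (fst @: M) set0 _) _.
    by apply/bicoverP => x y xyM; rewrite (imset_f fst xyM).
  by rewrite cards0 addn0 leq_imset_card.
- move=> [x y] [x' y'] xyM xyM' /= Ex; rewrite -Ex in xyM' *.
  by rewrite (minset_tau_inj1 minM xyM xyM').
- move=> [x y] [x' y'] xyM xyM' /= Ey; rewrite -Ey in xyM' *.
  rewrite -mem_swap_set in xyM; rewrite -mem_swap_set in xyM'.
  by rewrite (minset_tau_inj1 (minset_swap minM) xyM xyM').
Qed.

(** * Matchings and vertex covers of a cut *)

Section CutMatching.
Variables (G : sgraph) (A : {set G}).

Lemma edges_cut_graph (e : {set G}) : e \in edges (cut_graph A) ->
  exists x y : G, [/\ e = [set x; y], x -- y, x \in A & y \notin A].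
Proof.
move=> /imsetP [[x y] xyE ->]; have /andP [xy] : cut_adj A x y by rewrite inE in xyE.
case xA: (x \in A); case yA: (y \in A) => // _.
  by exists x, y; rewrite xA yA.
by exists y, x; rewrite xA yA adj_sym setUC.
Qed.

(** Each edge of a matching contains a vertex of [U]. Choosing one is injective, since matching
    edges are disjoint. *)
Lemma mm_le_cover (U : {set G}) :
  (forall x y, x -- y -> x \in A -> y \notin A -> (x \in U) || (y \in U)) ->
  mm A <= #|U|.
Proof.
move=> cov; apply/bigmax_leqP => M /andP [/subsetP sM /trivIsetP tM].
have rep (e : {set G}) : e \in M -> exists2 x, x \in e & x \in U.
  move=> /sM/edges_cut_graph [x [y [-> xy xA yA]]].
  case/orP: (cov _ _ xy xA yA) => h; first by exists x; rewrite ?inE ?eqxx.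
  by exists y; rewrite ?inE ?eqxx ?orbT.
pose f (e : {set G}) := [pick x in e :&: U].
have fP e : e \in M -> exists x, [/\ f e = Some x, x \in e & x \in U].
  move=> /rep [x xe xU]; rewrite /f; case: pickP => [y|/(_ x)].
    by rewrite inE => /andP [ye yU]; exists y.
  by rewrite inE xe xU.
rewrite -(card_in_imset (f := f)); last first.
  move=> e e' eM eM'; have [x [-> xe _]] := fP _ eM; have [y [-> ye _]] := fP _ eM'.
  move=> [xy]; apply/eqP/negPn/negP => ne; have := tM _ _ eM eM' ne.
  by rewrite disjoint_subset => /subsetP /(_ x xe); rewrite inE xy ye.
rewrite -(card_imset U Some_inj); apply/subset_leq_card/subsetP => _ /imsetP [e eM ->].
by have [x [-> _ xU]] := fP _ eM; apply: imset_f.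
Qed.

(** König's theorem for the edges of the cut, oriented from [A] to its complement. The second part
    of a cover may be trimmed to [~: A], where all heads lie. *)
Lemma cover_le_mm t :
  (forall X Y : {set G}, Y \subset ~: A ->
     (forall x y, x -- y -> x \in A -> y \notin A -> (x \in X) || (y \in Y)) ->
     t <= #|X| + #|Y|) ->
  t <= mm A.
Proof.
move=> h; pose E := [set p : G * G | [&& p.1 -- p.2, p.1 \in A & p.2 \notin A]].
have hE X Y : bicover E X Y -> t <= #|X| + #|Y|.
  move=> /bicoverP cov; apply: leq_trans (h X (Y :\: A) _ _) _.
  - by apply/subsetP => x; rewrite !inE => /andP [].
  - by move=> x y xy xA yA; have := cov x y; rewrite !inE /= xy xA yA; apply.
  - by rewrite leq_add2l subset_leq_card ?subsetDl.
have [M [/subsetP sM tM inj1 inj2]] := konig hE.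
have EM x y : (x, y) \in M -> [/\ x -- y, x \in A & y \notin A].
  by move/sM; rewrite inE /= => /and3P.
pose f (p : G * G) := [set p.1; p.2].
have meet p q z : p \in M -> q \in M -> z \in f p -> z \in f q -> p = q.
  case: p q => [x y] [x' y'] pM qM; rewrite !inE /=.
  have [_ xA yA] := EM _ _ pM; have [_ xA' yA'] := EM _ _ qM.
  case/orP=> /eqP -> /orP [] /eqP e.
  - by apply: inj1.
  - by move: yA'; rewrite -e xA.
  - by move: yA; rewrite e xA'.
  - by apply: inj2.
have mM : @is_matching (cut_graph A) (f @: M).
  apply/andP; split.
    apply/subsetP => _ /imsetP [[x y] /EM [xy xA yA] ->].
    by apply/imsetP; exists (x, y); rewrite // inE /adj /= /cut_adj xy xA (negbTE yA).
  apply/trivIsetP => _ _ /imsetP [p pM ->] /imsetP [q qM ->] ne.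
  rewrite disjoint_subset; apply/subsetP => z zp; rewrite inE.
  by apply: contraNN ne => zq; rewrite (meet _ _ _ pM qM zp zq).
apply: leq_trans tM _; rewrite -(card_in_imset (f := f)); last first.
  by move=> p q pM qM Ef; apply: (meet p q p.1) => //; rewrite -?Ef !inE eqxx.
exact: (@leq_bigmax_cond _ _ (fun M : {set {set cut_graph A}} => #|M|)).
Qed.

End CutMatching.

(** * Sides of the edges of a tree *)

Lemma connect_ind (T : finType) (e : rel T) (P : T -> Prop) x y :
  P x -> (forall z t, connect e x z -> P z -> e z t -> P t) -> connect e x y -> P y.
Proof.
move=> Px step /connectP [p].
have : connect e x x by [].
elim: p {1 3 4 5}x Px => [|t p IH] z Pz xz /=; first by move=> _ ->.
move=> /andP [zt pth] Ey; apply: (IH t) => //; first exact: step Pz zt.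
exact: connect_trans xz (connect1 zt).
Qed.

Lemma connect_img (T T' : finType) (e : rel T) (e' : rel T') (f : T -> T') x y :
  (forall z t, e z t -> connect e' (f z) (f t)) ->
  connect e x y -> connect e' (f x) (f y).
Proof.
move=> h; apply: (@connect_ind _ e (fun z => connect e' (f x) (f z))) => [//|z t _ xz /h zt].
exact: connect_trans xz zt.
Qed.

Lemma remove_edge_sym (G : sgraph) (a b : G) : symmetric (remove_edge a b).
Proof. by move=> x y; rewrite /remove_edge adj_sym setUC. Qed.

Lemma remove_edgeC (G : sgraph) (a b : G) : remove_edge a b =2 remove_edge b a.
Proof. by move=> x y; rewrite /remove_edge (setUC [set a]). Qed.

Lemma connect_removeC (G : sgraph) (a b x y : G) :
  connect (remove_edge a b) x y = connect (remove_edge b a) x y.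
Proof. exact: eq_connect (remove_edgeC a b) x y. Qed.

Lemma connect_remove_sym (G : sgraph) (a b x y : G) :
  connect (remove_edge a b) x y = connect (remove_edge a b) y x.
Proof. exact: (sym_connect_sym (remove_edge_sym a b)). Qed.

Lemma remove_edge_notin (G : sgraph) (a b x y : G) :
  x -- y -> x != a -> x != b -> remove_edge a b x y.
Proof.
move=> xy xa xb; rewrite /remove_edge xy; apply/eqP => /setP /(_ x).
by rewrite !inE eqxx (negbTE xa) (negbTE xb).
Qed.

Lemma adj_neq (G : sgraph) (x y : G) : x -- y -> x != y.
Proof. by apply: contraTneq => ->; rewrite adj_irrefl. Qed.

Lemma set2_eqE (T : finType) (x y a b : T) : [set x; y] = [set a; b] ->
  (x = a /\ y = b) \/ (x = b /\ y = a).
Proof.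
move=> E; have hx : x \in [set a; b] by rewrite -E set21.
have hy : y \in [set a; b] by rewrite -E set22.
have : a \in [set x; y] by rewrite E set21.
have : b \in [set x; y] by rewrite E set22.
case/set2P: hx => ->; case/set2P: hy => ->; rewrite !inE ?orbb.
- by move=> /eqP -> _; left.
- by left.
- by right.
- by move=> _ /eqP ->; left.
Qed.

(** A path from [x] to [y] that avoids the edge [xy] closes up to a cycle. Conversely, a cycle
    through [xy] minus this edge still joins its ends. The later arguments use only this bridge form
    of acyclicity. *)
Lemma acyclic_bridgeP (G : sgraph) :
  acyclic G <-> forall x y : G, x -- y -> ~~ connect (remove_edge x y) x y.
Proof.
split=> [acy x y xy|bridge [//|x [//|y [//|z q]]] Uc _].
  apply/negP => /connectP [p0 pth0 last0].
  case/shortenP: pth0 last0 => p pth Up _ Ey.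
  (* A path with a single step would be the removed edge itself. *)
  have sz : 2 < size (x :: p).
    move: pth Ey; case: p {Up} => [|t [|s p]] //=.
      by move=> _ yx; move: xy; rewrite yx adj_irrefl.
    by move=> /[swap] <-; rewrite /remove_edge eqxx andbF.
  have /negP := acy _ Up sz; apply.
  rewrite /= rcons_path -Ey adj_sym xy andbT.
  by apply: sub_path pth => a b /andP [].
apply/negP => /= /and3P [xy yz pth].
have xyNz : (z != x) && (z != y).
  move: Uc; rewrite /= !inE !negb_or => /and3P [/and3P [_ xz _] /andP [yz' _] _].
  by rewrite eq_sym xz eq_sym.
have Uq : (x \notin z :: q) && (y \notin z :: q).
  by move: Uc => /= /and3P []; rewrite !inE !negb_or => /and3P [_ -> ->] /andP [-> ->].
have h : connect (remove_edge x y) z x.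
  elim: q z pth Uq {Uc yz xyNz} => [|t q IH] z /=.
    rewrite andbT => zx; rewrite !inE => /andP [].
    by rewrite eq_sym => zx' zy; apply/connect1/remove_edge_notin => //; rewrite eq_sym.
  move=> /andP [zt pth]; rewrite !inE !negb_or.
  move=> /andP [/and3P [xz xt xq] /and3P [yz yt yq]].
  apply: (@connect_trans _ _ t).
    by apply/connect1/remove_edge_notin => //; rewrite eq_sym.
  by apply: IH => //; rewrite !inE !negb_or xt xq yt yq.
have /negP := bridge _ _ xy; apply; rewrite connect_remove_sym.
case/andP: xyNz => zx zy; apply: connect_trans h; rewrite connect_remove_sym.
by apply/connect1/remove_edge_notin; rewrite // adj_sym.
Qed.

Section Sides.
Variable T : sgraph.
Hypothesis treeT : is_tree T.
Implicit Types a b d x y z : T.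

(** For an edge [ab], this is the component of [a] in the tree minus [ab]. [bd_side] is its preimage
    under the leaf labelling. *)
Definition side a b z := connect (remove_edge a b) a z.

Lemma side_refl a b : side a b a.
Proof. exact: connect0. Qed.

(** Connectedness puts [z] on at least one side. Lying on both would join [a] to [b] without the
    bridge [ab]. *)
Lemma sideN a b z : a -- b -> side b a z = ~~ side a b z.
Proof.
have [_ conn /acyclic_bridgeP bridge] := treeT => ab.
have tot : side a b z || side b a z.
  apply: (@connect_ind _ (@adj T) (fun z => side a b z || side b a z) a z _ _ (conn a z)).
    by rewrite side_refl.
  move=> s t _ st1 st; have [E|ne] := eqVneq [set s; t] [set a; b].
    by case: (set2_eqE E) => -[_ ->]; rewrite side_refl ?orbT.
  have st' : remove_edge a b s t by rewrite /remove_edge st.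
  case/orP: st1 => h; apply/orP; [left|right]; apply: connect_trans h (connect1 _) => //.
  by rewrite remove_edgeC.
apply/idP/idP => [h|/negbTE h]; last by rewrite h in tot.
apply: contra (bridge _ _ ab) => h'; apply: connect_trans h' _.
by rewrite connect_remove_sym connect_removeC.
Qed.

(** A walk on the side of [a] never visits [b], so it survives the removal of [bd]; the edge [ab]
    survives because [a != d]. Sides therefore grow along a path. *)
Lemma side_mono a b d z :
  a -- b -> b -- d -> a != d -> side a b z -> side b d z.
Proof.
move=> ab bd ad h.
apply: (@connect_trans _ _ a).
  rewrite connect_remove_sym; apply/connect1/remove_edge_notin => //; exact: adj_neq.
apply: (@connect_ind _ _ (connect (remove_edge b d) a) _ _ _ _ h) => // s t.
rewrite -/(side a b s) => as_ cs /[dup] st /andP [st' _].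
have at_ : side a b t by apply: connect_trans as_ (connect1 st).
have neb r : side a b r -> r != b.
  by apply: contraTneq => ->; rewrite -sideN // side_refl.
apply: connect_trans cs (connect1 _).
rewrite /remove_edge st' /=; apply/eqP => /setP /(_ b).
rewrite !inE eqxx /= => /orP [] /eqP E.
  by have := neb _ as_; rewrite -E eqxx.
by have := neb _ at_; rewrite -E eqxx.
Qed.

Lemma path_side x y p :
  path (@adj T) x (y :: p) -> uniq (x :: y :: p) -> side y x (last y p).
Proof.
rewrite /side => /= /andP [xy pth] /andP [xp _].
elim: p y xy pth xp => [|t p IH] y xy //= /andP [yt pth].
rewrite !inE !negb_or => /and3P [xy' xt xp].
have : connect (remove_edge y x) y t.
  rewrite connect_remove_sym; apply/connect1; rewrite /remove_edge adj_sym yt /=.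
  apply/eqP => /setP /(_ x); rewrite !inE eqxx orbT.
  by rewrite (negbTE xt) (negbTE xy').
move=> h; apply: connect_trans h _.
elim: p t pth xt xp {IH yt} => [|s p IH] t //= /andP [ts pth] xt.
rewrite !inE !negb_or => /andP [xs xp].
apply: (@connect_trans _ _ s); last exact: IH.
apply/connect1; rewrite /remove_edge ts; apply/eqP => /setP /(_ x).
by rewrite !inE eqxx orbT (negbTE xt) (negbTE xs).
Qed.

Lemma side_path a b z : a -- b -> side b a z ->
  exists p, [/\ path (@adj T) a (b :: p), uniq (a :: b :: p) & last b p = z].
Proof.
move=> ab /connectP [p0 pth0 last0].
case/shortenP: pth0 last0 => p pth Up _ Ez; exists p; split => //.
  by rewrite /= ab; apply: sub_path pth => s t /andP [].
rewrite cons_uniq Up andbT; apply/negP => aP.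
have : side b a a by apply: (path_connect pth); rewrite inE in aP *.
by rewrite sideN // side_refl.
Qed.

(** * Edge sets closed under steps towards a vertex *)

Section Toward.
Variables (F : rel T) (l : T).
Hypothesis symF : symmetric F.
Hypothesis subF : forall x y, F x y -> x -- y.
Hypothesis towardF : forall a b d,
  F a b -> b -- d -> a != d -> side d b l -> F b d.

(** Along the path from [a] through [b] to [l], [towardF] passes membership in [F] from each edge to
    the next. *)
Lemma connect_toward a b : F a b -> side b a l -> connect F a l.
Proof.
move=> Fab /(side_path (subF Fab)) [p []].
elim: p a b Fab => [|d p IH] a b Fab pth Up El.
  by rewrite -El; apply: connect1.
apply: (connect_trans (connect1 Fab)).
have pth' : path (@adj T) b (d :: p) by case/andP: pth.
have Up' : uniq (b :: d :: p) by case/andP: Up.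
apply: (IH b d) => //; apply: (towardF Fab).
- by case/andP: pth'.
- by move: Up; rewrite /= !inE !negb_or => /andP [/and3P [_ ->]].
- by rewrite -El; apply: path_side.
Qed.

Definition span := [set x | [exists y, F x y]].

Lemma span_edge x y : F x y -> (x \in span) && (y \in span).
Proof.
move=> Fxy; rewrite !inE; apply/andP; split; apply/existsP; first by exists y.
by exists x; rewrite symF.
Qed.

Definition edge_subgraph := Subgraph symF subF span_edge.

Lemma span_connect x : x \in span -> connect F x l.
Proof.
rewrite inE => /existsP [y Fxy]; have := sideN l (subF Fxy).
case h : (side x y l) => /= h'; last exact: connect_toward Fxy h'.
apply: (connect_trans (connect1 Fxy)); apply: (@connect_toward y x) => //.
by rewrite symF.
Qed.

End Toward.
End Sides.

Lemma connect_subgraph (G : sgraph) (H : subgraph G) (x y : G)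
    (xH : x \in sub_vertices H) (yH : y \in sub_vertices H) :
  connect (sub_edge H) x y ->
  connect (@subgraph_adj G H) (exist _ x xH) (exist _ y yH).
Proof.
move=> /connectP [p]; elim: p x xH => [|z p IH] x xH /=.
  by move=> _ E; apply: eq_connect0; apply: val_inj.
move=> /andP [xz pth] E; have /andP [_ zH] := sub_edge_vertices xz.
apply: connect_trans (IH z zH pth E); exact: connect1.
Qed.

Lemma subgraph_connect (G : sgraph) (H : subgraph G) (x y : graph_of_subgraph H) :
  connect (@adj (graph_of_subgraph H)) x y -> connect (sub_edge H) (val x) (val y).
Proof. by apply: connect_img => z t zt; apply: connect1. Qed.

Lemma remove_edge_subgraph (G : sgraph) (H : subgraph G) (a b x y : graph_of_subgraph H) :
  connect (remove_edge a b) x y -> connect (remove_edge (val a) (val b)) (val x) (val y).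
Proof.
apply: connect_img => z t /andP [zt ne]; apply/connect1; rewrite /remove_edge.
rewrite (sub_edge_adj zt) /=; apply: contraNneq ne => E.
by case: (set2_eqE E) => -[/val_inj -> /val_inj ->]; rewrite // setUC.
Qed.

Lemma subgraph_acyclic (G : sgraph) (H : subgraph G) :
  acyclic G -> acyclic (graph_of_subgraph H).
Proof.
move=> /acyclic_bridgeP br; apply/acyclic_bridgeP => x y xy.
by apply: contra (br _ _ (sub_edge_adj xy)); apply: remove_edge_subgraph.
Qed.

(** The common source of subtrees below: if [F] is closed under steps towards [l], every end of an
    edge of [F] is joined to [l] inside [F], which gives connectedness. Acyclicity is inherited from
    [T]. *)
Lemma edge_subtree (T : sgraph) (F : rel T) l (symF : symmetric F)
    (subF : forall x y, F x y -> x -- y) :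
  is_tree T -> (exists x y, F x y) ->
  (forall a b d, F a b -> b -- d -> a != d -> side d b l -> F b d) ->
  is_subtree (edge_subgraph symF subF).
Proof.
move=> treeT [x0 [y0 Fxy0]] tow; split.
- apply/card_gt0P; have /andP [xs _] := span_edge symF Fxy0.
  by exists (exist _ x0 xs).
- move=> [x xs] [y ys]; apply: connect_subgraph => /=.
  apply: (@connect_trans _ _ l).
    exact: (span_connect treeT symF subF tow xs).
  rewrite (sym_connect_sym symF).
  exact: (span_connect treeT symF subF tow ys).
- by apply: subgraph_acyclic; case: treeT.
Qed.

(** * Linked vertex covers of cuts *)

Section TightSets.
Variable G : sgraph.
Implicit Types (A P S : {set G}) (v x y : G).

Definition nbhd S := [set y | [exists x in S, x -- y]].

Lemma nbhdP S y : reflect (exists2 x, x \in S & x -- y) (y \in nbhd S).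
Proof.
rewrite inE; apply: (iffP existsP) => [[x /andP []]|[x xS xy]]; first by exists x.
by exists x; rewrite xS.
Qed.

Lemma nbhdS S S' : S \subset S' -> nbhd S \subset nbhd S'.
Proof.
move=> /subsetP sS; apply/subsetP => y /nbhdP [x /sS xS' xy].
by apply/nbhdP; exists x.
Qed.

(* The size of the vertex cover [(A :\: S) :|: (nbhd S :\: A)] of the cut of
   [A]; every minimal vertex cover of the cut has this form. *)
Definition cover_size A S := #|A :\: S| + #|nbhd S :\: A|.

(* The smallest set attaining the minimum of [cover_size A]; the second summand
   breaks ties. *)
Definition tight A :=
  [arg min_(S < set0 | S \subset A) (cover_size A S * #|G|.+1 + #|S|)].

Lemma tight_sub A : tight A \subset A.
Proof. by rewrite /tight; case: arg_minnP; rewrite ?sub0set. Qed.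

(** The factor [#|G|.+1] exceeds the size of every vertex set, so the weighted sum compares pairs
    lexicographically. *)
Lemma tight_le A S : S \subset A -> cover_size A (tight A) <= cover_size A S.
Proof.
rewrite /tight; case: arg_minnP; rewrite ?sub0set // => S0 _ minS0 /minS0.
have := max_card (mem S); set a := cover_size _ _; set b := cover_size _ _.
set c := #|_|; set d := #|_|; set e := #|_|; move: a b c d e; clear; nia.
Qed.

(** A smaller set of no larger cost would beat [tight A] on the tie-breaking summand. *)
Lemma tight_lt A S : S \proper tight A -> cover_size A (tight A) < cover_size A S.
Proof.
rewrite /tight; case: arg_minnP; rewrite ?sub0set // => S0 sS0 minS0 pS.
have := minS0 S (subset_trans (proper_sub pS) sS0).
have := proper_card pS; set a := cover_size _ _; set b := cover_size _ _.
set c := #|_|; set d := #|_|; set e := #|_|; move: a b c d e; clear; nia.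
Qed.

(** The first summands of [cover_size] add up to the same total on both sides. The neighbourhood
    terms are compared through the unions and intersections of the sets, as in [leq_cards2]. *)
Lemma cover_size_submod A A' S S' : A \subset A' -> S \subset A -> S' \subset A' ->
  cover_size A (S :&: S') + cover_size A' (S :|: S') <=
  cover_size A S + cover_size A' S'.
Proof.
move=> sA sS sS'; rewrite /cover_size addnACA [leqRHS]addnACA; apply: leq_add.
  rewrite !cardsD (setIidPr sS) (setIidPr sS').
  have sI : S :&: S' \subset A by apply: subset_trans sS; apply: subsetIl.
  have sU : S :|: S' \subset A' by rewrite subUset sS' (subset_trans sS).
  rewrite (setIidPr sI) (setIidPr sU).
  have := cardsUI S S'; have := subset_leq_card sS; have := subset_leq_card sS'.
  have := subset_leq_card sI; have := subset_leq_card sU.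
  set a := #|_|; set b := #|_|; set c := #|_|; set d := #|_|; set e := #|_|.
  set f := #|_|; move: a b c d e f; clear; lia.
apply: leq_cards2; apply/subsetP => y; rewrite !(in_setU, in_setI, in_setD).
  case/orP=> /andP [yA /nbhdP [x]]; rewrite inE => xS xy.
    by case/andP: xS => xS _; apply/orP; left; rewrite yA; apply/nbhdP; exists x.
  apply/orP; case/orP: xS => xS; [left|right]; last first.
    by rewrite yA; apply/nbhdP; exists x.
  by rewrite (contra (subsetP sA y) yA); apply/nbhdP; exists x.
case/andP=> /andP [yA /nbhdP [x]]; rewrite inE => /andP [xS xS'] xy /andP [yA' _].
rewrite yA yA' /=; apply/andP; split; apply/nbhdP; by exists x.
Qed.

(** Otherwise [tight A :&: tight A'] would cost strictly more than [tight A] for [A]. Since the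
    union costs at least as much as [tight A'] for [A'], this contradicts submodularity. *)
Lemma tightS A A' : A \subset A' -> tight A \subset tight A'.
Proof.
move=> sA; have sub := cover_size_submod sA (tight_sub A) (tight_sub A').
have sU : tight A :|: tight A' \subset A'.
  by rewrite subUset tight_sub (subset_trans (tight_sub A)).
have leU := tight_le sU; apply/setIidPl/eqP.
rewrite eqEproper subsetIl /=; apply/negP => /tight_lt.
by move: sub leU; clear; lia.
Qed.

(** Removing [X] from [tight A] adds [#|X|] to the first summand of the cost and lowers the second
    by at least [#|Y|]. By [tight_lt] the cost must strictly increase. *)
Lemma tight_disjoint_card A A' x y : [disjoint A & A'] ->
  x \in tight A -> y \in tight A' -> x -- y ->
  #|nbhd (tight A) :&: tight A'| < #|nbhd (tight A') :&: tight A|.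
Proof.
move=> dA xA yA' xy; set Y := _ :&: tight A'; set X := _ :&: tight A.
have sX : X \subset tight A by apply: subsetIr.
have xX : x \in X by rewrite inE xA andbT; apply/nbhdP; exists y; rewrite // adj_sym.
have pS : tight A :\: X \proper tight A.
  apply/properP; split; first exact: subsetDl.
  by exists x; rewrite // in_setD xX.
have lt := tight_lt pS.
have sYA : Y \subset nbhd (tight A) :\: A.
  apply/subsetP => z; rewrite in_setI in_setD => /andP [-> zA'].
  by rewrite (disjointFl dA) // (subsetP (tight_sub A')).
have sN : nbhd (tight A :\: X) :\: A \subset (nbhd (tight A) :\: A) :\: Y.
  apply/subsetP => z; rewrite !in_setD => /andP [-> /nbhdP [w]].
  rewrite in_setD => /andP [wX wA] wz.
  have zN : z \in nbhd (tight A) by apply/nbhdP; exists w.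
  rewrite zN !andbT; apply: contra wX => zY.
  rewrite inE wA andbT; apply/nbhdP; exists z; last by rewrite adj_sym.
  by move: zY; rewrite inE => /andP [].
have := subset_leq_card sN; rewrite [#|_ :\: Y|]cardsD (setIidPr sYA).
have := subset_leq_card sYA; have := subset_leq_card sX.
have := subset_leq_card (tight_sub A).
move: lt; rewrite /cover_size !cardsD (setIidPr (tight_sub A)).
rewrite (setIidPr (subset_trans (subsetDl _ X) (tight_sub A))) cardsD (setIidPr sX).
set c1 := #|tight A|; set c2 := #|A|; set c3 := #|X|; set c4 := #|Y|.
set c5 := #|nbhd (tight A)| - _; set c6 := #|_| - #|_ :&: A|.
by move: c1 c2 c3 c4 c5 c6; clear; lia.
Qed.

(** An edge between the two sets would give the strict inequality of [tight_disjoint_card] in both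
    directions. *)
Lemma tight_disjoint A A' x y : [disjoint A & A'] ->
  x \in tight A -> y \in tight A' -> ~~ (x -- y).
Proof.
move=> dA xA yA'; apply/negP => xy.
have h := tight_disjoint_card dA xA yA' xy.
rewrite disjoint_sym in dA; rewrite adj_sym in xy.
by have := ltn_trans h (tight_disjoint_card dA yA' xA xy); rewrite ltnn.
Qed.

Definition min_cover A := (A :\: tight A) :|: (nbhd (tight A) :\: A).

(** For any cover given by [X] and [Y], the set [A :\: X] costs at most [#|X| + #|Y|]. So the
    minimum cost is a lower bound for all covers, and König's theorem applies. *)
Lemma card_min_cover A : #|min_cover A| <= mm A.
Proof.
apply: leq_trans (_ : cover_size A (tight A) <= _).
  by rewrite cardsU leq_subr.
apply: cover_le_mm => X Y sY cov.
apply: leq_trans (tight_le (subsetDl A X)) _; apply: leq_add.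
  by rewrite setDDr setDv set0U subset_leq_card ?subsetIr.
apply/subset_leq_card/subsetP => y; rewrite in_setD => /andP [yA /nbhdP [x]].
rewrite in_setD => /andP [/negbTE xX xA] xy.
by have := cov _ _ xy xA yA; rewrite xX.
Qed.

Lemma mem_min_cover A v :
  (v \in min_cover A) = if v \in A then v \notin tight A else v \in nbhd (tight A).
Proof.
rewrite in_setU !in_setD; case: (v \in A); first by rewrite andbT andFb orbF.
by rewrite andbF.
Qed.

Lemma min_cover_cut A x y : x -- y -> x \in A -> y \notin A ->
  (x \in min_cover A) || (y \in min_cover A).
Proof.
move=> xy xA yA; rewrite !mem_min_cover xA (negbTE yA).
by case: (boolP (x \in tight A)) => //= xt; apply/nbhdP; exists x.
Qed.

Lemma min_cover0 : min_cover set0 = set0.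
Proof.
have /eqP t0 : tight set0 == set0 by rewrite -subset0 tight_sub.
rewrite /min_cover t0 set0D set0U setD0; apply/setP => y; rewrite in_set0.
by apply/negP => /nbhdP [x]; rewrite in_set0.
Qed.

(* A cover of the cut of [P] depending only on the partition [{P, ~: P}]: of the
   two sides, the one avoiding [x0] is used, so that any two sides arising from
   edges of a tree are nested or disjoint. *)
Definition cut_cover x0 P := min_cover (if x0 \in P then ~: P else P).

Lemma cut_coverC x0 P : cut_cover x0 (~: P) = cut_cover x0 P.
Proof. by rewrite /cut_cover inE setCK; case: (x0 \in P). Qed.

(** If [x0] lies in [P], or outside [P'], the sides in use are nested and [tightS] applies. If [x0]
    lies only in [P'], the sides [P] and [~: P'] are disjoint, and [tight_disjoint] keeps a
    neighbour of [tight P] out of [tight (~: P')]. *)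
Lemma cut_cover_linked x0 P P' v : P \subset P' -> v \notin P' ->
  v \in cut_cover x0 P -> v \in cut_cover x0 P'.
Proof.
move=> sP vP'; have vP := contra (subsetP sP v) vP'.
have [vC vC'] : v \in ~: P /\ v \in ~: P' by rewrite !in_setC.
rewrite /cut_cover; case x0P: (x0 \in P).
  have x0P' : x0 \in P' := subsetP sP _ x0P; rewrite x0P'.
  rewrite [in X in X -> _]mem_min_cover [in X in _ -> X]mem_min_cover vC vC'.
  by apply: contra; apply/subsetP/tightS; rewrite setCS.
rewrite [in X in X -> _]mem_min_cover (negbTE vP) => vN.
case x0P': (x0 \in P'); rewrite mem_min_cover ?vC' ?(negbTE vP'); last first.
  by apply: subsetP vN; apply/nbhdS/tightS.
case/nbhdP: vN => x xt; apply: contraL => vt.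
by apply: tight_disjoint xt vt; rewrite disjoints_subset setCK.
Qed.

(* The cut at the leaf of [v] must be covered by [v] itself, also when [v] is
   isolated or when the smallest cover is its only neighbour. *)
Definition linked_cover x0 P :=
  if [pick v | (P == [set v]) || (P == ~: [set v])] is Some v then [set v]
  else cut_cover x0 P.

Lemma linked_coverC x0 P : linked_cover x0 (~: P) = linked_cover x0 P.
Proof.
rewrite /linked_cover cut_coverC.
rewrite (@eq_pick _ _ (fun v => (P == [set v]) || (P == ~: [set v]))) // => v.
by rewrite (can2_eq (@setCK _) (@setCK _)) (inj_eq (@setC_inj _)) orbC.
Qed.

Lemma linked_cover_card x0 P k : 0 < k -> mm P <= k -> mm (~: P) <= k ->
  #|linked_cover x0 P| <= k.
Proof.
move=> k0 mP mC; rewrite /linked_cover; case: pickP => [v _|_]; first by rewrite cards1.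
rewrite /cut_cover; apply: leq_trans (card_min_cover _) _.
by case: (x0 \in P).
Qed.

Lemma linked_cover_cut x0 P x y : x -- y -> x \in P -> y \notin P ->
  (x \in linked_cover x0 P) || (y \in linked_cover x0 P).
Proof.
move=> xy xP yP; rewrite /linked_cover; case: pickP => [v|_].
  case/orP=> /eqP E; move: xP yP; rewrite E !inE; first by move=> ->.
  by move=> _; rewrite negbK orbC => ->.
rewrite /cut_cover; case: (x0 \in P); last exact: min_cover_cut.
by rewrite orbC; apply: min_cover_cut; rewrite ?inE ?xP // adj_sym.
Qed.

Hypothesis G3 : 2 < #|G|.

(** With two vertices, a singleton is also the complement of the other one, and the choice made in
    [linked_cover] would be ambiguous. *)
Lemma set1_neqC v w : [set v] != ~: [set w].
Proof.
by apply: contraTneq G3 => /(congr1 (fun A => #|pred_of_set A|)); rewrite cardsC1 cards1; lia.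
Qed.

Lemma linked_cover1 x0 v : linked_cover x0 [set v] = [set v].
Proof.
rewrite /linked_cover; case: pickP => [w|/(_ v)]; last by rewrite eqxx.
by rewrite (negbTE (set1_neqC _ _)) orbF => /eqP ->.
Qed.

Lemma linked_coverS x0 P P' v : P \subset P' -> v \notin P' ->
  v \in linked_cover x0 P -> v \in linked_cover x0 P'.
Proof.
move=> sP vP'; have vP := contra (subsetP sP v) vP'.
rewrite {1}/linked_cover; case: pickP => [w|pickN].
  move=> wP; rewrite inE => /eqP vw; subst w.
  case/orP: wP => /eqP E; first by rewrite E inE eqxx in vP.
  have -> : P' = ~: [set v].
    apply/eqP; rewrite eqEsubset -{2}E sP andbT.
    by apply/subsetP => x xP'; rewrite !inE; apply: contraNneq vP' => <-.
  by rewrite linked_coverC linked_cover1 inE.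
move=> vC; rewrite /linked_cover; case: pickP => [w|_]; last exact: cut_cover_linked vC.
case/orP=> /eqP E.
  (* Here [P] is [[set w]], which [pickN] excludes, or empty, and the cover of the empty side is
     empty. *)
  move: sP; rewrite E subset1 => /orP [] /eqP P0; move: (pickN w).
    by rewrite P0 eqxx.
  by move: vC; rewrite P0 /cut_cover in_set0 min_cover0 in_set0.
by move: vP'; rewrite E !inE negbK.
Qed.

End TightSets.

(** * Attaching a leaf to an edge of a tree *)

Section Subdivide.
Variables (T : sgraph) (a b : T).
Hypothesis ab : a -- b.

Local Notation T' := (option (option T)).

(* The edge [ab] is subdivided by the vertex [None], to which the leaf
   [Some None] is attached. *)
Definition sub_adj (x y : T') : bool :=
  match x, y with
  | Some (Some x), Some (Some y) => remove_edge a b x y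
  | None, Some (Some x) | Some (Some x), None => (x == a) || (x == b)
  | None, Some None | Some None, None => true
  | _, _ => false
  end.

Lemma sub_adj_sym : symmetric sub_adj.
Proof. by move=> [[x|]|] [[y|]|] //=; rewrite remove_edge_sym. Qed.

Lemma sub_adj_irrefl : irreflexive sub_adj.
Proof. by move=> [[x|]|] //=; rewrite /remove_edge adj_irrefl. Qed.

Definition subdivide := SGraph sub_adj_sym sub_adj_irrefl.

Definition old (x : T) : subdivide := Some (Some x).
Definition mid : subdivide := None.
Definition tip : subdivide := Some None.

Definition contract (c : T) (x : subdivide) : T :=
  if x is Some (Some y) then y else c.

(* Both halves of the subdivided edge inherit [F a b]; [t] decides the edge to
   [tip]. *)
Definition sub_rel (t : bool) (F : rel T) : rel subdivide := fun x y =>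
  match x, y with
  | Some (Some x), Some (Some y) => F x y && ([set x; y] != [set a; b])
  | None, Some (Some x) | Some (Some x), None => F a b && ((x == a) || (x == b))
  | None, Some None | Some None, None => t
  | _, _ => false
  end.

Lemma sub_rel_sym t F : symmetric F -> symmetric (sub_rel t F).
Proof. by move=> symF [[x|]|] [[y|]|] //=; rewrite symF setUC. Qed.

Lemma sub_rel_adj t (F : rel T) (x y : subdivide) :
  (forall x y, F x y -> x -- y) -> sub_rel t F x y -> x -- y.
Proof.
move=> subF; move: x y => [[x|]|] [[y|]|] //=; rewrite /adj /=.
- by move=> /andP [/subF xy ne]; rewrite /remove_edge xy.
- by case/andP.
- by case/andP.
Qed.

Lemma sub_rel_connect t F x y : symmetric F ->
  connect F x y -> connect (sub_rel t F) (old x) (old y).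
Proof.
move=> symF; apply: connect_img => z s zs.
case: (eqVneq [set z; s] [set a; b]) => [E|ne]; last first.
  by apply: connect1; rewrite /= zs.
have Fab : F a b by case: (set2_eqE E) zs => -[-> ->] //; rewrite symF.
apply: (@connect_trans _ _ mid); apply: connect1;
  by rewrite /= Fab; case: (set2_eqE E) => -[Ez Es]; rewrite ?Ez ?Es eqxx ?orbT.
Qed.

Hypothesis treeT : is_tree T.

Lemma subdivide_connected : connected subdivide.
Proof.
have [_ conn _] := treeT.
have E : sub_rel true (@adj T) =2 sub_adj.
  by move=> [[x|]|] [[y|]|] //=; rewrite ab.
have oo x y : connect sub_adj (old x) (old y).
  rewrite -(eq_connect E); apply: sub_rel_connect => //; exact: adj_sym.
have to_a x : connect sub_adj x (old a).
  case: x => [[x|]|]; first exact: oo.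
    apply: (@connect_trans _ _ mid); first exact: connect1.
    by apply: connect1; rewrite /= eqxx.
  by apply: connect1; rewrite /= eqxx.
move=> x y; apply: connect_trans (to_a x) _.
by rewrite (sym_connect_sym sub_adj_sym).
Qed.

(** A walk avoiding an old edge, or one half of [ab], is contracted to a walk of [T] avoiding a
    bridge. For the half at [c], both new vertices go to the other end [d], so that the remaining
    half collapses. The edge at [tip] is the only one there. *)
Lemma subdivide_bridge (x y : subdivide) :
  x -- y -> ~~ connect (remove_edge x y) x y.
Proof.
have [_ _ /acyclic_bridgeP bridge] := treeT.
have old_old s t : remove_edge a b s t ->
    ~~ connect (remove_edge (old s) (old t)) (old s) (old t).
  move=> /andP [st ne]; apply: contra (bridge _ _ st).
  apply: (connect_img (f := contract a)) => z w /andP [].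
  have ab' : connect (remove_edge s t) a b.
    by apply: connect1; rewrite /remove_edge ab eq_sym.
  move: z w => [[z|]|] [[w|]|] //=.
  - move=> /andP [zw _] ne'; apply: connect1; rewrite /remove_edge zw.
    by apply: contraNneq ne' => /set2_eqE [] [-> ->]; rewrite // setUC.
  - by case/orP => /eqP ->; rewrite // connect_remove_sym.
  - by case/orP => /eqP ->.
have old_mid c d : c -- d -> [set c; d] = [set a; b] ->
    ~~ connect (remove_edge mid (old c)) mid (old c).
  move=> cd E; apply: contra (bridge _ _ cd); rewrite connect_remove_sym => h.
  apply: (connect_img (f := contract d) _ h) => z w /andP [].
  have Ec v : (v == a) || (v == b) -> v = c \/ v = d.
    by move=> va; apply/set2P; rewrite E !inE.
  move: z w => [[z|]|] [[w|]|] //=.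
  - move=> /andP [zw zw'] _; apply: connect1; rewrite /remove_edge zw.
    by rewrite E.
  - move=> /Ec [] ->; by rewrite // setUC eqxx.
  - move=> /Ec [] ->; by rewrite // eqxx.
have mid_tip : ~~ connect (remove_edge tip mid) tip mid.
  apply/negP => h; suff: mid = tip by [].
  apply: (connect_ind (P := fun z => z = tip) _ _ h) => // z s _ ->.
  by case: s => [[s|]|] //= /andP [_]; rewrite eqxx.
have ba : b -- a by rewrite adj_sym.
have swap s t : ~~ connect (@remove_edge subdivide s t) s t ->
    ~~ connect (@remove_edge subdivide t s) t s.
  by rewrite connect_remove_sym connect_removeC.
move: x y => [[x|]|] [[y|]|] //=.
- exact: old_old.
- case/orP=> /eqP ->; apply: swap; first exact: (old_mid a b).
  by apply: (old_mid b a); rewrite // setUC.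
- case/orP=> /eqP ->; first exact: (old_mid a b).
  by apply: (old_mid b a); rewrite // setUC.
- by move=> _; apply: swap.
Qed.

Lemma subdivide_tree : is_tree subdivide.
Proof.
split; [|exact: subdivide_connected|exact/acyclic_bridgeP/subdivide_bridge].
by apply/card_gt0P; exists mid.
Qed.

(** The map [f] replaces the neighbour across [ab], if any, by [mid]. Hence leaves placed earlier
    remain leaves. *)
Lemma degree_old x : degree (old x) = degree x.
Proof.
pose f (y : T) : subdivide := if [set x; y] == [set a; b] then mid else old y.
have f_inj : {in [set y | x -- y] &, injective f}.
  move=> y z _ _; rewrite /f; case: eqP => [E|_]; case: eqP => [E'|_] //; last by case.
  move=> _; rewrite -E in E'; by case: (set2_eqE E') => -[] // -> <-.
rewrite /degree -(card_in_imset f_inj); apply: eq_card => y; rewrite inE.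
apply/idP/imsetP => [|[z]]; last first.
  rewrite inE /f => xz ->; case: eqP => [E|/eqP ne].
    by rewrite /adj /=; have := set21 x z; rewrite E !inE.
  by rewrite /adj /= /remove_edge xz.
case: y => [[y|]|] //; rewrite {1}/adj /=.
  by move=> /andP [xy /negbTE ne]; exists y; rewrite ?inE // /f ne.
case/orP=> /eqP Ex; first by exists b; rewrite ?inE /f Ex ?eqxx.
by exists a; rewrite ?inE /f Ex 1?setUC ?eqxx // adj_sym.
Qed.

Lemma degree_tip : degree tip = 1.
Proof.
apply/eqP/cards1P; exists mid; apply/setP => -[[y|]|]; rewrite !inE //.
Qed.

Lemma degree_mid : degree mid <= 3.
Proof.
have : [set y | mid -- y] \subset [:: old a; old b; tip].
  apply/subsetP => -[[y|]|]; rewrite !inE // /adj /=.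
  by case/orP => /eqP ->; rewrite eqxx ?orbT.
by move/subset_leq_card/leq_trans; apply; apply: card_size.
Qed.

Lemma subdivide_subcubic : subcubic T -> subcubic subdivide.
Proof.
move=> sc [[x|]|]; [|by rewrite degree_tip|exact: degree_mid].
by rewrite (degree_old x).
Qed.

End Subdivide.

(** * From subtrees to branch decompositions *)

Lemma leaf_side (T : sgraph) (x y z : T) : is_leaf x -> x -- y -> side x y z -> z = x.
Proof.
move=> /cards1P [w /setP Ew] xy; have E s : (x -- s) = (s == w).
  by have := Ew s; rewrite !inE.
have yw s : x -- s -> s = y by move: xy; rewrite !E => /eqP -> /eqP.
apply: (connect_ind (P := fun z => z = x)) => // s t _ -> /andP [/yw ->].
by rewrite eqxx.
Qed.

Lemma leaf_edge (T : sgraph) (x : T) : is_leaf x -> exists y, x -- y.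
Proof.
by move=> /cards1P [y /setP /(_ y)]; rewrite !inE eqxx; exists y.
Qed.

(** The vertex [w] is the next one on the path from [x] to [z]; it provides a second edge at [x]. *)
Lemma side_step (T : sgraph) (x y z : T) : is_tree T -> x -- y -> side x y z -> z != x ->
  exists w, [/\ x -- w, w != y & side w x z].
Proof.
move=> treeT xy /connectP [p0 pth0 last0].
case/shortenP: pth0 last0 => -[|w p] pth Up _ /= Ez; first by rewrite Ez eqxx.
move=> _; case/andP: (pth) => /andP [xw ne] _; exists w; split => //.
  by apply: contraNneq ne => ->.
rewrite Ez; apply: path_side => //; apply: sub_path pth => s t /andP [] //.
Qed.

Lemma degree_subgraph (G : sgraph) (H : subgraph G) (x : graph_of_subgraph H) :
  degree x <= degree (val x).
Proof.
rewrite /degree -(card_imset _ val_inj); apply/subset_leq_card/subsetP.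
move=> _ /imsetP [y + ->]; rewrite !inE; exact: sub_edge_adj.
Qed.

Lemma mem_bd_side (X : finType) (D : branch_dec X) (a b : bd_tree D) l :
  (bd_map l \in bd_side a b) = side a b (val l).
Proof.
have [g gK _] := bd_map_bij D; rewrite mem_imset ?inE //; exact: can_inj gK.
Qed.

Lemma mmw_leP (G : sgraph) k : 1 < #|G| ->
  mmw G <= k <-> exists D : branch_dec G, mm_width D <= k.
Proof.
move=> G1; rewrite /mmw; case: ltnP => [G1'|]; last by rewrite leqNgt G1.
case: ex_minnP => m /boolp.asboolP [D Dm] minm; split=> [mk|[D' Dk]].
  by exists D; rewrite Dm.
by apply: leq_trans Dk; apply: minm; apply/boolp.asboolP; exists D'.
Qed.

(** * Placing the vertices on leaves, and pruning *)

Section TreeModel.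
Variables (G : sgraph) (k : nat).

(* [tm_rel u] is the edge relation of the subtree of [u]; the vertices [u] in
   [D] have already been placed on a leaf [tm_pos u] of the tree. *)
Record tree_model (D : {set G}) := TreeModel {
  tm_tree : sgraph;
  tm_rel : G -> rel tm_tree;
  tm_pos : G -> tm_tree;
  tm_is_tree : is_tree tm_tree;
  tm_subcubic : subcubic tm_tree;
  tm_sym : forall u, symmetric (tm_rel u);
  tm_adj : forall u x y, tm_rel u x y -> x -- y;
  tm_leaf : forall u, u \in D -> is_leaf (tm_pos u);
  tm_inj : {in D &, injective tm_pos};
  tm_edge : forall u, u \notin D -> exists y, tm_rel u (tm_pos u) y;
  tm_meet : forall u v, u -- v -> exists x,
    connect (tm_rel u) (tm_pos u) x /\ connect (tm_rel v) (tm_pos v) x;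
  tm_count : forall x y, x -- y -> #|[set u | tm_rel u x y]| <= k }.

(** An edge [ab] of the subtree of [u] at its position is subdivided and [u] moves to [tip]. Both
    halves carry the subtrees that contained [ab]; the new pendant edge carries only that of [u],
    which [0 < k] allows. *)
Lemma tree_model_insert (D : {set G}) u : 0 < k -> u \notin D ->
  tree_model D -> inhabited (tree_model (u |: D)).
Proof.
move=> k0 uD [T F p treeT sc symF subF leafp injp edgep meetp cnt].
have [b Fab] := edgep u uD; set a := p u in Fab; have ab := subF _ _ _ Fab.
pose F' w : rel (subdivide a b) := @sub_rel _ a b (w == u) (F w).
pose p' w : subdivide a b := if w == u then tip a b else old a b (p w).
have posF' w x : connect (F w) (p w) x -> connect (F' w) (p' w) (old a b x).
  move=> /(sub_rel_connect a b (w == u) (symF w)) h.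
  rewrite /p'; case: eqP => [wu|//]; apply: connect_trans h; rewrite /F' wu eqxx.
  apply: (@connect_trans _ _ (mid a b)); apply: connect1; first by [].
  by rewrite /= Fab eqxx.
constructor; apply: (@TreeModel _ (subdivide a b) F' p').
- exact: subdivide_tree.
- exact: subdivide_subcubic.
- by move=> w; apply: sub_rel_sym.
- by move=> w x y; apply: sub_rel_adj => //; apply: subF.
- move=> w; rewrite !inE /p'; case: eqP => [_ _|_ /=]; first by rewrite /is_leaf degree_tip.
  by move=> /leafp; rewrite /is_leaf degree_old.
- move=> w w'; rewrite !inE /p'; case: eqP => [->|_]; case: eqP => [->|_] //=.
  by move=> wD w'D [] /injp ->.
- move=> w; rewrite !inE negb_or /p' => /andP [/negbTE wu /edgep [y Fy]].
  (* If the edge known for [w] was [ab] itself, its half at [p w] takes over. *)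
  rewrite wu /F' wu; case: (eqVneq [set p w; y] [set a; b]) => [E|ne]; last first.
    by exists (old a b y); rewrite /= Fy.
  exists (mid a b); rewrite /=; have := set21 (p w) y; rewrite E !inE => ->.
  by case: (set2_eqE E) Fy => -[-> ->]; rewrite ?andbT // symF => ->.
- move=> w w' /meetp [x [/posF' h /posF' h']]; by exists (old a b x).
- have cab : #|[set w | F w a b]| <= k by apply: cnt.
  move=> [[x|]|] [[y|]|] //.
  + move=> /andP [xy _]; apply: leq_trans (cnt _ _ xy); apply/subset_leq_card/subsetP => w.
    by rewrite !inE => /andP [].
  + move=> _; apply: leq_trans cab; apply/subset_leq_card/subsetP => w.
    by rewrite !inE => /andP [].
  + move=> _; apply: leq_trans k0; rewrite -(cards1 u); apply/subset_leq_card/subsetP => w.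
    by rewrite !inE.
  + move=> _; apply: leq_trans cab; apply/subset_leq_card/subsetP => w.
    by rewrite !inE => /andP [].
  + move=> _; apply: leq_trans k0; rewrite -(cards1 u); apply/subset_leq_card/subsetP => w.
    by rewrite !inE.
Qed.

Lemma tree_model_full : 0 < k -> tree_model set0 -> inhabited (tree_model setT).
Proof.
move=> k0 m0; have [n] := ubnP #|~: (set0 : {set G})|; elim: n (set0) m0 => [//|n IH] D m.
case: (set_0Vmem (~: D)) => [D0 _|[u]].
  by move: m; rewrite -[D]setCK D0 setC0.
rewrite inE => uD lt; have [m'] := tree_model_insert k0 uD m.
rewrite ltnS in lt; apply: (IH _ m'); apply: leq_trans lt; apply: proper_card.
apply/properP; split; first by rewrite setCS subsetUr.
by exists u; rewrite !inE ?eqxx.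
Qed.

Lemma tree_model_branch_dec : 1 < #|G| -> tree_model setT ->
  exists D : branch_dec G, mm_width D <= k.
Proof.
move=> G1 [T F p treeT sc symF subF leafp injp _ meetp cnt].
(* The good edges separate two placed leaves; the pruned tree consists of them. *)
pose good x y := [&& x -- y, [exists u, side x y (p u)] & [exists u, side y x (p u)]].
have good_sym : symmetric good.
  by move=> x y; rewrite /good adj_sym andbA andbAC -andbA.
have good_adj x y : good x y -> x -- y by case/and3P.
have good_toward u a b d : good a b -> b -- d -> a != d -> side d b (p u) -> good b d.
  move=> /and3P [ab /existsP [v av] _] bd ad du; apply/and3P; split => //; apply/existsP.
    by exists v; apply: side_mono av.
  by exists u.
have good_leaf u y : p u -- y -> good (p u) y.
  move=> uy; apply/and3P; split => //; apply/existsP; first by exists u; apply: side_refl.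
  have [v vu] : exists v, v != u.
    have /card_gt1P [s [t [_ _ st]]] := G1.
    by case: (eqVneq s u) => [su|]; [exists t; rewrite -su eq_sym|exists s].
  exists v; rewrite sideN //; apply: contra vu => /(leaf_side (leafp u (in_setT _)) uy).
  by move=> /(injp _ _ (in_setT _) (in_setT _)) ->.
have leaf_span u : p u \in span good.
  have [y /good_leaf h] := leaf_edge (leafp u (in_setT _)).
  by rewrite inE; apply/existsP; exists y.
have [u0 _] : exists u : G, u \in G by apply/card_gt0P; apply: ltnW.
pose H := edge_subgraph good_sym good_adj.
have treeH : is_tree (graph_of_subgraph H).
  apply: (edge_subtree good_sym good_adj treeT _ (@good_toward u0)).
  have [y /good_leaf h] := leaf_edge (leafp u0 (in_setT _)).
  by exists (p u0), y.
have scH : subcubic (graph_of_subgraph H).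
  by move=> x; apply: leq_trans (degree_subgraph x) (sc _).
pose q u : graph_of_subgraph H := exist _ (p u) (leaf_span u).
have leafq u : is_leaf (q u).
  rewrite /is_leaf eqn_leq; apply/andP; split.
    by apply: leq_trans (degree_subgraph _) _; rewrite (eqP (leafp u (in_setT _))).
  have [y /good_leaf h] := leaf_edge (leafp u (in_setT _)).
  have /andP [_ ys] := span_edge good_sym h.
  by apply/card_gt0P; exists (exist _ y ys); rewrite inE.
pose g u : leaf (graph_of_subgraph H) := exist _ (q u) (leafq u).
(* Pruning creates no new leaves: if [x] is no [p u], the good edge [xy] has some [p u] behind [x],
   and the first edge [xw] towards it is good as well, so [x] has degree at least [2]. *)
have surj l : exists u, g u = l.
  case: l => -[x xs] lx; suff [u Eu] : exists u, p u = x.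
    by exists u; apply/val_inj/val_inj.
  move: (xs); rewrite inE => /existsP [y xy].
  case/and3P: (xy) => xy' /existsP [u xu] /existsP [v yv].
  case: (eqVneq (p u) x) => [|ux]; first by exists u.
  have [w [xw wy wu]] := side_step treeT xy' xu ux.
  have gxw : good x w by apply: (good_toward u y) => //; rewrite 1?good_sym // eq_sym.
  have /andP [_ ys] := span_edge good_sym xy; have /andP [_ ws] := span_edge good_sym gxw.
  case/cards1P: lx => z /setP Ez.
  have := Ez (exist _ y ys); have := Ez (exist _ w ws); rewrite !inE.
  rewrite {1}/adj /= /subgraph_adj /= gxw => /esym/eqP zw.
  rewrite xy => /esym/eqP zy.
  by move: wy; have [->] := etrans zw (esym zy); rewrite eqxx.
have [f fK] := fin_all_exists surj.
have gK : cancel g f.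
  move=> u; apply: (injp _ _ (in_setT _) (in_setT _)).
  by have /(congr1 (fun l => val (val l))) := fK (g u).
pose D := BranchDec treeH scH (Bijective fK gK); exists D.
apply/bigmax_leqP => -[x y] xy; have xy' := sub_edge_adj xy.
apply: leq_trans (cnt _ _ xy'); apply: mm_le_cover => u v uv.
have memD w a b : (w \in @bd_side _ D a b) = side a b (q w).
  by rewrite -{1}(gK w) (@mem_bd_side _ D).
rewrite !memD -(sideN treeH) //= !inE.
move=> /remove_edge_subgraph /= xu /remove_edge_subgraph /= yv.
apply/negPn/negP; rewrite negb_or => /andP [nu nv].
(* A subtree that does not contain [xy] stays on one side of it. If this held for both [u] and [v],
   their common vertex would put [p u] and [p v] on the same side. *)
have keep w z : ~~ F w (val x) (val y) -> connect (F w) (p w) z ->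
    connect (remove_edge (val x) (val y)) (p w) z.
  move=> nw; apply: (@connect_img _ _ _ _ id) => s t st.
  apply: connect1; rewrite /remove_edge (subF _ _ _ st).
  apply: contra nw => /eqP /set2_eqE [] [<- <-] //; by rewrite symF.
have [z [uz vz]] := meetp _ _ uv.
have yv' : side (val y) (val x) (p v) := yv.
suff xv : side (val x) (val y) (p v) by have := sideN treeT (p v) xy'; rewrite xv yv'.
apply: connect_trans xu _; apply: connect_trans (keep _ _ nu uz) _.
by rewrite connect_remove_sym; apply: keep.
Qed.

End TreeModel.

(** The subtrees form a tree model with no vertex placed, each position being an end of some edge of
    the subtree. *)
Lemma mmw_of_subtrees (G : sgraph) (k : nat) (T : sgraph) (S : G -> subgraph T) :
  1 < #|G| -> 0 < k -> is_tree T -> subcubic T ->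
  (forall u, is_subtree (S u) /\ exists x y, sub_edge (S u) x y) ->
  (forall u v, u -- v -> exists x, x \in sub_vertices (S u) /\ x \in sub_vertices (S v)) ->
  (forall x y : T, x -- y -> #|[set u | sub_edge (S u) x y]| <= k) ->
  mmw G <= k.
Proof.
move=> G1 k0 treeT sc subS meetS cnt.
have [p pP] := fin_all_exists (fun u => proj2 (subS u)).
apply/(mmw_leP _ G1); suff [m] : inhabited (tree_model k (set0 : {set G})).
  have [m'] := tree_model_full k0 m; exact: tree_model_branch_dec G1 m'.
have inS u : p u \in sub_vertices (S u).
  by have [y /sub_edge_vertices /andP []] := pP u.
have conS u x : x \in sub_vertices (S u) -> connect (sub_edge (S u)) (p u) x.
  move=> xS; have [[_ conn _] _] := subS u.
  exact: (subgraph_connect (conn (exist _ (p u) (inS u)) (exist _ x xS))).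
constructor; apply: (@TreeModel _ _ _ T (fun u => sub_edge (S u)) p) => //.
- by move=> u; apply: sub_edge_sym.
- by move=> u; apply: sub_edge_adj.
- by move=> u; rewrite inE.
- by move=> u v; rewrite inE.
- by move=> u v /meetS [x [xu xv]]; exists x; split; apply: conS.
Qed.

(** * From branch decompositions to subtrees *)

Definition subtree_model (G : sgraph) k (T : sgraph) (S : G -> subgraph T) : Prop :=
  [/\ is_tree T, subcubic T,
      forall u, is_subtree (S u) /\ (exists x y : T, sub_edge (S u) x y),
      forall u v : G, u -- v ->
        exists x : T, x \in sub_vertices (S u) /\ x \in sub_vertices (S v) &
      forall x y : T, x -- y -> #|[set u : G | sub_edge (S u) x y]| <= k].

Section Covers.
Variables (G : sgraph) (k : nat) (D : branch_dec G).
Hypotheses (G3 : 2 < #|G|) (k0 : 0 < k) (widthD : mm_width D <= k).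

Local Notation T := (bd_tree D).
Let treeT : is_tree T := bd_is_tree D.

Lemma bd_side_inv : exists l : G -> T,
  [/\ injective l, forall u, is_leaf (l u) &
      forall u a b, (u \in @bd_side _ D a b) = side a b (l u)].
Proof.
have [g gK fK] := bd_map_bij D; exists (fun u => val (g u)); split.
- exact: inj_comp val_inj (can_inj fK).
- by move=> u; apply: valP.
- by move=> u a b; rewrite -{1}(fK u) mem_bd_side.
Qed.

Lemma subtrees_of_branch_dec : exists S : G -> subgraph T, subtree_model k S.
Proof.
have [l [injl leafl memS]] := bd_side_inv.
have [x0 _] : exists u : G, u \in G by apply/card_gt0P; apply: leq_trans G3.
have sideC (x y : T) : x -- y -> bd_side y x = ~: bd_side x y.
  by move=> xy; apply/setP => u; rewrite in_setC !memS sideN.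
pose C (x y : T) := linked_cover x0 (bd_side x y).
pose F v (x y : T) := (x -- y) && (v \in C x y).
have symF v : symmetric (F v).
  move=> x y; rewrite /F (adj_sym x y); apply: andb_id2l => yx.
  by rewrite /C (sideC _ _ yx) linked_coverC.
have subF v x y : F v x y -> x -- y by case/andP.
(* Towards the leaf of [v] the sides behind grow and never contain [v], so [linked_coverS] keeps [v]
   in the cover. *)
have towF v a b d : F v a b -> b -- d -> a != d -> side d b (l v) -> F v b d.
  move=> /andP [ab vC] bd ad dv; rewrite /F bd; apply: linked_coverS vC => //.
    by apply/subsetP => u; rewrite !memS; apply: side_mono.
  by rewrite memS -sideN.
have leafF v y : l v -- y -> F v (l v) y.
  move=> vy; rewrite /F vy /C; have -> : bd_side (l v) y = [set v].
    apply/setP => u; rewrite memS inE; apply/idP/eqP => [|->]; last exact: side_refl.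
    by move=> /(leaf_side (leafl v) vy) /injl.
  by rewrite linked_cover1 // set11.
have spanF v : l v \in span (F v).
  have [y /leafF vy] := leaf_edge (leafl v).
  by rewrite inE; apply/existsP; exists y.
exists (fun v => edge_subgraph (symF v) (subF v)); split => //.
- exact: bd_subcubic.
- move=> v; have [y vy] := leaf_edge (leafl v).
  have ex : exists x y, F v x y by exists (l v), y; apply: leafF.
  by split=> //; apply: edge_subtree (towF v).
- move=> u v uv /=.
  have step (x y : T) : x -- y -> side x y (l u) -> side y x (l v) ->
      y \in span (F u) \/ x \in span (F v).
    move=> xy xu yv; have /orP [uC|vC] : (u \in C x y) || (v \in C x y).
    - by apply: linked_cover_cut; rewrite // memS -?sideN.
    - left; have Fu : F u x y by rewrite /F xy.
      by have /andP [] := span_edge (symF u) Fu.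
    - right; have Fv : F v x y by rewrite /F xy.
      by have /andP [] := span_edge (symF v) Fv.
  (* The walk goes from the leaf of [u] to that of [v], staying in the subtree of [u]. By [step],
     either it can advance one edge or the current vertex is already in the subtree of [v]; the last
     vertex always is. *)
  have walk p (x y : T) : path (@adj T) x (y :: p) -> uniq (x :: y :: p) ->
      last y p = l v -> side x y (l u) -> x \in span (F u) ->
      exists x, x \in span (F u) /\ x \in span (F v).
    elim: p x y => [|d p IH] x y pth Up Ev xu xs; have /andP [xy pth'] := pth;
      have := path_side pth Up; rewrite Ev => yv;
      have [ys|xs'] := step _ _ xy xu yv; try by exists x.
      by exists y; split=> //; rewrite /= in Ev; rewrite Ev.
    apply: (IH y d) => //; first by case/andP: Up.
    have /andP [yd _] := pth'; apply: side_mono xu => //.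
    by move: Up; rewrite /= !inE !negb_or => /andP [/and3P []].
  have [_ conn _] := treeT; have /connectP [p0 pth0 last0] := conn (l u) (l v).
  case/shortenP: pth0 last0 => -[|y p] pth Up _ /= Ev.
    by move/adj_neq: uv; rewrite (injl _ _ Ev) eqxx.
  by apply: (walk p (l u) y) => //; apply: side_refl.
- move=> x y xy; have wk (a b : T) : a -- b -> mm (bd_side a b) <= k.
    move=> ab; apply: leq_trans widthD.
    exact: (@leq_bigmax_cond _ (fun p : T * T => p.1 -- p.2)
      (fun p => mm (bd_side p.1 p.2)) (a, b)).
  rewrite (_ : [set u | _] = C x y); last by apply/setP => u; rewrite inE /= /F xy.
  by apply: linked_cover_card => //; rewrite -?sideC //; apply: wk; rewrite // adj_sym.
Qed.

End Covers.

(** * Graphs with at most two vertices *)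

Section SingleEdge.
Variables (T : sgraph) (x y : T).

Definition single_edge : rel T := fun a b => (a -- b) && ([set a; b] == [set x; y]).

Lemma single_edge_sym : symmetric single_edge.
Proof. by move=> a b; rewrite /single_edge adj_sym setUC. Qed.

Lemma single_edge_adj a b : single_edge a b -> a -- b.
Proof. by case/andP. Qed.

Definition single_edge_subgraph := edge_subgraph single_edge_sym single_edge_adj.

Lemma single_edge_subtree : is_tree T -> x -- y -> is_subtree single_edge_subgraph.
Proof.
move=> treeT xy; apply: (edge_subtree (l := x)) => //.
  by exists x, y; rewrite /single_edge xy eqxx.
(* The closure condition holds vacuously: a step that leaves the edge [xy] never leads towards
   [x]. *)
move=> a b d /andP [ab /eqP E] bd ad; rewrite sideN //.
case: (set2_eqE E) => -[Ea Eb]; rewrite Eb in ab bd *; last by rewrite side_refl.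
by rewrite (side_mono treeT ab bd ad) // Ea side_refl.
Qed.

End SingleEdge.

Lemma caterpillar_is_tree n : 0 < n -> is_tree (caterpillar n).
Proof.
move=> n0; split; [|exact: caterpillar_connected|exact: caterpillar_acyclic].
by apply/card_gt0P; exists (inl (Ordinal n0)).
Qed.

(** In the path [caterpillar 2], the vertex [u] receives the edge [xy] and any other vertex the
    adjacent edge [yz], so all subtrees share [y] and each edge lies in at most one of them. *)
Lemma subtrees_of_two (G : sgraph) k (u v : G) : #|G| <= 2 -> 0 < k -> u -- v ->
  exists (T : sgraph) (S : G -> subgraph T), subtree_model k S.
Proof.
move=> G2 k0 uv; exists (caterpillar 2).
pose x : caterpillar 2 := inr ord0; pose y : caterpillar 2 := inl ord0.
pose z : caterpillar 2 := inl ord_max.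
have treeT := @caterpillar_is_tree 2 isT.
have xy : x -- y by []. have yz : y -- z by [].
pose S w := if w == u then single_edge_subgraph x y else single_edge_subgraph y z.
have yS w : y \in sub_vertices (S w).
  rewrite /S; case: eqP => _; rewrite inE; apply/existsP; [exists x|exists z];
  by rewrite /single_edge ?yz ?eqxx // adj_sym setUC eqxx.
exists S; split => //.
- exact: caterpillar_subcubic.
- move=> w; rewrite /S; case: eqP => _.
    split; first exact: single_edge_subtree.
    by exists x, y; rewrite /= /single_edge xy eqxx.
  split; first exact: single_edge_subtree.
  by exists y, z; rewrite /= /single_edge yz eqxx.
- by move=> w w' _; exists y.
- move=> a b ab; apply: leq_trans k0.
  case: (eqVneq [set a; b] [set x; y]) => [E|ne].
    apply: (@leq_trans #|[set u]|); last by rewrite cards1.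
    apply/subset_leq_card/subsetP => w; rewrite !inE /S.
    case: eqP => //= _; rewrite /single_edge E => /andP [_ /eqP /setP /(_ x)].
    by rewrite !inE eqxx.
  apply: (@leq_trans #|[set~ u]|); last by rewrite cardsC1; lia.
  apply/subset_leq_card/subsetP => w; rewrite !inE /S.
  by case: eqP => //=; rewrite /single_edge (negbTE ne) andbF.
Qed.

Theorem theorem5 :
  forall (G : sgraph) (k : nat),
    (exists u v : G, u -- v) ->
    0 < k ->
    (mmw G <= k <->
     exists (T : sgraph) (S : G -> subgraph T),
       [/\ is_tree T,
           subcubic T,
           forall u : G,
             is_subtree (S u) /\ (exists x y : T, sub_edge (S u) x y),
           forall u v : G, u -- v ->
             exists x : T, x \in sub_vertices (S u) /\ x \in sub_vertices (S v) &
           forall x y : T, x -- y ->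
             #|[set u : G | sub_edge (S u) x y]| <= k]).
Proof.
move=> G k [u [v uv]] k0.
have G1 : 1 < #|G| by apply/card_gt1P; exists u, v; rewrite adj_neq.
split=> [|[T [S [treeT sc subS meetS cnt]]]]; last exact: mmw_of_subtrees cnt.
move=> /(mmw_leP _ G1) [D widthD].
case: (leqP #|G| 2) => [G2|G3]; first exact: subtrees_of_two uv.
by exists (bd_tree D); apply: subtrees_of_branch_dec.
Qed.
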